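(* Let $n\ge1$ and let $\vec a=(a_0,\dots,a_n)$ be a tropical boolean vector (i.e. $a_0=a_n=0$ and each $a_i$, $0\le i\le n$, equals either $0$ or $\infty$). Let $G=G_{\vec a}$ be the finite directed graph defined in the context, with $Q_T$, $d(T)$, $n(T)$ as defined there. Then for every path $T$ of length $k\ge0$ in $G$, $\dim(Q_T)=d(T)+n(T)$. Moreover, for every $k\ge 0$ the union of the polyhedra $Q_T$ over all paths $T$ of length $k$ in $G$ coincides with the tropical prevariety of all tropical recurrent sequences of length $k+n$ satisfying $\vec a$.
   Context: A real sequence $(z_1,\dots,z_k)$ is a tropical recurrent sequence satisfying $\vec a$ if for every $1\le j\le k-n$ the (finite) minimum $\min_{0\le i\le n}\{z_{j+i}+a_i\}$ is attained for at least two different values of $i$; terms with $a_i=\infty$ equal $\infty$. Vertices of $G$: they correspond to the nonempty polyhedra $P_v\subset\mathbb{R}^n$ obtained by imposing, for each pair of coordinates $y_r,y_t$, exactly one of $y_r=y_t$, $y_r<y_t$, $y_t<y_r$ (i.e. to the weak orderings of the $n$ coordinates); the $P_v$ partition $\mathbb{R}^n$. Edges of $G$: there is an edge $(v,w)$ iff there exist $(y_0,\dots,y_{n-1})\in P_v$ and $(y_1,\dots,y_n)\in P_w$ such that $(y_0,\dots,y_n)$ satisfies $\vec a$. For a vertex $v$ and $(y_0,\dots,y_{n-1})\in P_v$ let $S_v$ be the set of $t\in\{0,\dots,n-1\}$ with $a_t+y_t=\min_{0\le j\le n-1}\{a_j+y_j\}$ (independent of the point). An edge $(v,w)$ is augmenting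 if $S_v\ne\{0\}$ and on $P_w$ the last coordinate is different from each of the first $n-1$ coordinates; it is rigid otherwise, i.e. if either $S_v=\{0\}$ or on $P_w$ the last coordinate equals one of the first $n-1$ coordinates. For a path $T$ with vertices $v_0,\dots,v_k$ (length $k$), $Q_T\subset\mathbb{R}^{k+n}$ is the polyhedron of all $(y_1,\dots,y_{k+n})$ satisfying $\vec a$ with $(y_{i+1},\dots,y_{i+n})\in P_{v_i}$ for $0\le i\le k$. $d(T)$ is the number of augmenting edges in $T$ (counted along the path), and $n(T)\le n$ is the number of pairwise distinct coordinates of a point of $P_{v_0}$. *)

(* Defs.v *)
From HB Require Import structures.
From mathcomp Require Import all_boot all_order all_algebra.
From mathcomp Require Import boolp classical_sets reals constructive_ereal.

Set Implicit Arguments.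
Unset Strict Implicit.
Unset Printing Implicit Defensive.

Import Order.TTheory GRing.Theory Num.Theory.

Local Open Scope classical_set_scope.
Local Open Scope ring_scope.

(* Coordinates are numbered from 0. [entry] is total: it returns 0 out of
   range, but every use below stays in range. *)
Definition entry (R : realType) (m : nat) (z : 'rV[R]_m) (j : nat) : R :=
  oapp (z ord0) 0 (insub j).

Definition window (R : realType) (m : nat) (z : 'rV[R]_m) (l i : nat) :
  'rV[R]_l := \row_(s < l) entry z (i + s)%N.

Definition argmins (R : realType) (m : nat) (f : 'I_m -> \bar R) : {set 'I_m} :=
  [set t | f t == \big[mine/+oo%E]_(i < m) f i].

Definition tropical_boolean (R : realType) (n : nat) (a : 'I_n.+1 -> \bar R) :
  Prop :=
  [/\ a ord0 = 0%E, a ord_max = 0%E & forall i, a i = 0%E \/ a i = +oo%E].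

Definition tropical_recurrent (R : realType) (n : nat) (a : 'I_n.+1 -> \bar R)
    (m : nat) (z : 'rV[R]_m) : Prop :=
  forall j : nat, (j + n < m)%N ->
    (1 < #|argmins (fun i : 'I_n.+1 => (entry z (j + i)%N)%:E + a i)%E|)%N.

(* The finType structure on [comparison], making the vertex set finite. *)
Definition comparison_code (c : comparison) : option bool :=
  match c with Eq => None | Lt => Some true | Gt => Some false end.
Definition comparison_decode (o : option bool) : comparison :=
  match o with None => Eq | Some true => Lt | Some false => Gt end.
Lemma comparison_codeK : cancel comparison_code comparison_decode.
Proof. by case. Qed.
HB.instance Definition _ := Finite.copy comparison (can_type comparison_codeK).

Definition comparison_holds (R : realType) (c : comparison) (x y : R) : Prop :=
  match c with Eq => x = y | Lt => x < y | Gt => y < x end.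

Definition cell (R : realType) (n : nat)
    (c : {ffun 'I_n * 'I_n -> comparison}) : set 'rV[R]_n :=
  [set y | forall r t, comparison_holds (c (r, t)) (y ord0 r) (y ord0 t)].

(* Requiring a nonempty cell discards the inconsistent patterns, so that the
   remaining ones are in bijection with the weak orderings of the coordinates. *)
Definition vertex (R : realType) (n : nat) : Type :=
  {c : {ffun 'I_n * 'I_n -> comparison} | `[< cell (R := R) c !=set0 >]}.

Definition Pv (R : realType) (n : nat) (v : vertex R n) : set 'rV[R]_n :=
  cell (val v).

Definition edge (R : realType) (n : nat) (a : 'I_n.+1 -> \bar R)
    (v w : vertex R n) : Prop :=
  exists y : 'rV[R]_n.+1,
    [/\ Pv v (window y n 0), Pv w (window y n 1) & tropical_recurrent a y].

Definition point (R : realType) (n : nat) (v : vertex R n) : 'rV[R]_n :=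
  xget 0 (Pv v).

Definition argmins_at (R : realType) (n : nat) (a : 'I_n.+1 -> \bar R)
    (y : 'rV[R]_n) : {set 'I_n} :=
  argmins (fun t : 'I_n => a (widen_ord (leqnSn n) t) + (y ord0 t)%:E)%E.

(* For tropical boolean [a] the choice of the point of [Pv v] is irrelevant,
   see [SvE]; likewise for [distinct_coords], see [distinct_coordsE]. *)
Definition Sv (R : realType) (n : nat) (a : 'I_n.+1 -> \bar R)
    (v : vertex R n) : {set 'I_n} := argmins_at a (point v).

Definition distinct_at (R : realType) (n : nat) (y : 'rV[R]_n) : nat :=
  size (undup [seq y ord0 i | i : 'I_n]).

Definition distinct_coords (R : realType) (n : nat) (v : vertex R n) : nat :=
  distinct_at (point v).

Definition last_coord_new (R : realType) (n : nat) (w : vertex R n) : Prop :=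
  forall y, Pv w y -> forall s t : 'I_n,
    t = n.-1 :> nat -> (s < n.-1)%N -> y ord0 t <> y ord0 s.

Definition augmenting (R : realType) (n : nat) (a : 'I_n.+1 -> \bar R)
    (v w : vertex R n) : Prop :=
  [/\ edge a v w, Sv a v <> [set t : 'I_n | t == 0%N :> nat]%SET &
      last_coord_new w].

Definition is_path (R : realType) (n : nat) (a : 'I_n.+1 -> \bar R) (k : nat)
    (T : 'I_k.+1 -> vertex R n) : Prop :=
  forall i : 'I_k, edge a (T (widen_ord (leqnSn k) i)) (T (lift ord0 i)).

Definition QT (R : realType) (n : nat) (a : 'I_n.+1 -> \bar R) (k : nat)
    (T : 'I_k.+1 -> vertex R n) : set 'rV[R]_(k + n) :=
  [set y | tropical_recurrent a y /\
           forall i : 'I_k.+1, Pv (T i) (window y n i)].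

Definition num_augmenting (R : realType) (n : nat) (a : 'I_n.+1 -> \bar R)
    (k : nat) (T : 'I_k.+1 -> vertex R n) : nat :=
  #|[set i : 'I_k |
      `[< augmenting a (T (widen_ord (leqnSn k) i)) (T (lift ord0 i)) >]]%SET|.

Definition affine_hull (R : realType) (m : nat) (A : set 'rV[R]_m) :
  set 'rV[R]_m :=
  [set x | exists (l : nat) (p : 'I_l -> 'rV[R]_m) (c : 'I_l -> R),
     [/\ forall i, A (p i), \sum_i c i = 1 & x = \sum_i c i *: p i]].

(* The dimension of a polyhedron is that of its affine hull; the empty set has
   no dimension in this sense. *)
Definition has_dim (R : realType) (m : nat) (A : set 'rV[R]_m) (d : nat) :
  Prop :=
  exists (x : 'rV[R]_m) (U : {vspace 'rV[R]_m}),
    affine_hull A = [set x + u | u in [set u | u \in U]] /\ \dim U = d.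

Lemma has_dim_uniq (R : realType) (m : nat) (A : set 'rV[R]_m) (d e : nat) :
  has_dim A d -> has_dim A e -> d = e.
Proof.
have sub (x y : 'rV[R]_m) (U V : {vspace 'rV[R]_m}) :
    [set x + u | u in [set u | u \in U]] = [set y + u | u in [set u | u \in V]] ->
    (U <= V)%VS.
  move=> E; apply/subvP => u uU.
  have [v0 v0V e0] : [set y + u | u in [set u | u \in V]] x.
    by rewrite -E; exists 0; rewrite ?addr0 //= mem0v.
  have [v1 v1V e1] : [set y + u | u in [set u | u \in V]] (x + u).
    by rewrite -E; exists u.
  suff -> : u = v1 - v0 by rewrite rpredB.
  by apply: (addrI x); rewrite -e1 -e0 -addrA [v0 + _]addrC subrK.
move=> [x [U [EU <-]]] [y [V [EV <-]]].
suff -> : U = V by [].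
by apply: subv_anti; apply/andP; split; [apply: (sub x y)|apply: (sub y x)];
  rewrite -EU -EV.
Qed.

Lemma pointP (R : realType) (n : nat) (v : vertex R n) : Pv v (point v).
Proof. by case: v => c hc; apply: xgetPex; apply/asboolP. Qed.

Lemma Pv_le (R : realType) (n : nat) (v : vertex R n) (y z : 'rV[R]_n) r t :
  Pv v y -> Pv v z -> (y ord0 r <= y ord0 t) = (z ord0 r <= z ord0 t).
Proof.
move=> /(_ r t) + /(_ r t); rewrite /comparison_holds.
case: (val v (r, t)) => [-> ->|h1 h2|h1 h2]; first by rewrite !lexx.
  by rewrite !ltW.
by rewrite !leNgt h1 h2.
Qed.

Lemma in_argmins (R : realType) (m : nat) (f : 'I_m -> \bar R) (t : 'I_m) :
  (t \in argmins f) = [forall i, (f t <= f i)%E].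
Proof.
rewrite inE; apply/eqP/forallP => [-> i|h]; first exact: bigmin_le_cond.
by apply/le_anti/andP; split; [apply/bigmin_geP; rewrite leey|apply: bigmin_le_cond].
Qed.

Lemma SvE (R : realType) (n : nat) (a : 'I_n.+1 -> \bar R) (v : vertex R n)
    (y : 'rV[R]_n) :
  tropical_boolean a -> Pv v y -> Sv a v = argmins_at a y.
Proof.
move=> [_ _ ha] vy; apply/setP => t; rewrite !in_argmins.
apply: eq_forallb => i.
case: (ha (widen_ord (leqnSn n) t)) => ->;
  case: (ha (widen_ord (leqnSn n) i)) => ->;
  rewrite ?add0e ?addye ?leey ?leye_eq // lee_fin.
exact: Pv_le (pointP v) vy.
Qed.

Lemma distinct_coordsE (R : realType) (n : nat) (v : vertex R n)
    (y : 'rV[R]_n) :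
  Pv v y -> distinct_coords v = distinct_at y.
Proof.
move=> vy; rewrite /distinct_coords /distinct_at /image_mem.
have heq r t : (point v ord0 r == point v ord0 t) = (y ord0 r == y ord0 t).
  by rewrite !eq_le !(Pv_le _ _ (pointP v) vy).
elim: (enum _) => //= i s IH.
have -> : (point v ord0 i \in [seq point v ord0 j | j <- s]) =
          (y ord0 i \in [seq y ord0 j | j <- s]).
  by elim: s {IH} => //= j s IH; rewrite !inE heq IH.
by case: ifP => //= _; rewrite IH.
Qed.

(* Main.v *)
Require Import Defs.
From HB Require Import structures.
From mathcomp Require Import all_boot all_order all_algebra.
From mathcomp Require Import boolp classical_sets reals constructive_ereal.

(** Read a sequence of Q_T from left to right. Given the first m terms, the m-th
    one is either equal to an earlier term, at a position depending only on T
    (rigid), or can still take at least two values (free). Both use that an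
    order isomorphism between finite sets of reals extends to one more point:
    the condition imposed by a boolean vector only depends on the order of the
    terms, so any point of P_v can be continued along an edge (v, w) as the
    witness of that edge is. Since Q_T is stable under doubling, its affine hull
    is a linear space U; by a filtration argument dim U is the number of
    positions at which some vector of U has its first nonzero coordinate, and
    these are the free positions: n(T) among the first n terms, then one for
    each augmenting edge. *)

Set Implicit Arguments.
Unset Strict Implicit.
Unset Printing Implicit Defensive.

Import Order.TTheory GRing.Theory Num.Theory.

Local Open Scope classical_set_scope.
Local Open Scope ring_scope.

(** * Dimension as a count of leading positions *)

(** Filter [U] by the subspaces of vectors vanishing at the first [m] positions; the step from [m]
    to [m+1] lowers the dimension by [D m], and the last subspace is zero. *)
Lemma dim_leading_positions (F : fieldType) (N : nat) (U : {vspace 'rV[F]_N})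
    (D : pred 'I_N) :
  (forall j u, ~~ D j -> u \in U ->
     (forall i : 'I_N, (i < j)%N -> u ord0 i = 0) -> u ord0 j = 0) ->
  (forall j, D j -> exists2 u, u \in U &
     (forall i : 'I_N, (i < j)%N -> u ord0 i = 0) /\ u ord0 j != 0) ->
  \dim U = (\sum_(j < N) D j)%N.
Proof.
move=> rigid free.
have filtration m : exists V : {vspace 'rV[F]_N},
    (forall u, u \in V <->
       u \in U /\ forall i : 'I_N, (i < m)%N -> u ord0 i = 0) /\
    \dim U = (\dim V + \sum_(j < N | (j < m)%N) D j)%N.
  elim: m => [|m [V [VE dV]]].
    by exists U; rewrite big_pred0 ?addn0 //; split=> // u; split=> // -[].
  have [mN|Nm] := ltnP m N; last first.
    exists V; split=> [u|]; last first.
      rewrite dV; congr addn; apply: eq_bigl => j.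
      by rewrite !(leq_trans (ltn_ord j)) // leqW.
    rewrite VE; split=> -[uU h]; split=> // i _; apply: h.
      exact: leq_trans Nm.
    by rewrite ltnS (leq_trans (ltnW (ltn_ord i))).
  pose j := Ordinal mN; pose f : 'Hom('rV[F]_N, 'cV[F]_1) := linfun (col j).
  have fE u : (u \in lker f) = (u ord0 j == 0).
    rewrite memv_ker lfunE /=; apply/eqP/eqP => [/colP /(_ ord0)|h].
      by rewrite !mxE.
    by apply/colP => x; rewrite !mxE !ord1.
  exists (V :&: lker f)%VS; split=> [u|].
    rewrite memv_cap fE; split=> [/andP[/VE[uU h] /eqP uj]|[uU h]].
      split=> // i; rewrite ltnS leq_eqVlt => /orP[/eqP ij|/h//].
      by rewrite (_ : i = j) //; apply: val_inj.
    apply/andP; split; last by apply/eqP/h.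
    by apply/VE; split=> // i im; apply/h/leqW.
  (* Rank-nullity: the drop is the dimension of the image of [V] under coordinate [j]. It lies in a
     line, and is the whole line exactly when [D j] holds. *)
  rewrite dV -(limg_ker_dim f V) -addnA; congr addn.
  rewrite (bigD1 (P := fun i : 'I_N => (i < m.+1)%N) j) //=; congr addn; last first.
    by apply: eq_bigl => i; rewrite ltnS ltn_neqAle -val_eqE andbC.
  have [Dj|Dj] := boolP (D j).
    have [u uU [u0 uj]] := free j Dj.
    have uV : u \in V by apply/VE; split.
    apply/eqP; rewrite eqn_leq; apply/andP; split.
      by apply: leq_trans (dimvS (subvf _)) _; rewrite dimvf dim_matrix.
    rewrite lt0n dimv_eq0; apply: contraNneq uj => f0.
    by rewrite -fE memv_ker -memv0 -f0 memv_img.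
  apply/eqP; rewrite dimv_eq0 -subv0; apply/subvP => _ /memv_imgP[u uV ->].
  rewrite memv0 -memv_ker fE; apply/eqP.
  by have [uU u0] := (VE u).1 uV; apply: rigid.
have [V [VE ->]] := filtration N.
rewrite (eq_bigl xpredT) => [|j]; last exact: ltn_ord.
suff -> : V = 0%VS by rewrite dimv0.
apply/eqP; rewrite -subv0; apply/subvP => u /VE[_ u0].
by rewrite memv0; apply/eqP/rowP => i; rewrite mxE; apply: u0.
Qed.

(* Doubling lets the coefficients of a linear combination be corrected to add
   up to 1: [0 = 2 *: y - (2 *: y)] carries the total coefficient [2 - 1]. *)
Lemma affine_hull_vspace (R : realType) (m : nat) (A : set 'rV[R]_m) :
  A !=set0 -> (forall y, A y -> A (2 *: y)) ->
  exists U : {vspace 'rV[R]_m}, forall x, affine_hull A x <-> x \in U.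
Proof.
move=> [y0 Ay0] double.
(* A finite family in [A] whose span has maximal dimension: adding a point of [A] cannot enlarge the
   span, so the span contains [A]. *)
pose P d := `[< exists X : seq 'rV[R]_m,
  (forall y, y \in X -> A y) /\ \dim <<X>> = d >].
have exP : exists d, P d.
  by exists (\dim <<[::] : seq 'rV[R]_m>>%VS); apply/asboolP; exists [::].
have leP d : P d -> (d <= \dim {:'rV[R]_m})%N.
  by move=> /asboolP[X [_ <-]]; apply/dimvS/subvf.
case: (ex_maxnP exP leP) => d /asboolP[X [XA dX]] dmax.
have AX y : A y -> y \in <<X>>%VS.
  move=> Ay; suff -> : <<X>>%VS = (<[y]> + <<X>>)%VS.
    by apply: (subvP (addvSl _ _)); apply: memv_line.
  apply/eqP; rewrite eqEdim addvSr /= dX dmax //; apply/asboolP.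
  exists (y :: X); rewrite span_cons; split=> // z.
  by rewrite inE => /orP[/eqP ->|/XA].
exists <<X>>%VS => x; split=> [[l [p [c [pA _ ->]]]]|xX].
  by apply: memv_suml => i _; apply/memvZ/AX/pA.
pose t := in_tuple X; pose e := 1 - \sum_i coord t i x.
pose cons2 T (u v : T) (w : 'I_(size X) -> T) (i : 'I_(size X).+2) :=
  if unlift ord0 i is Some j then
    if unlift ord0 j is Some h then w h else v
  else u.
(* The points [2 *: y0] with weight [- e] and [y0] with weight [2 * e] cancel as vectors and supply
   the missing total weight [e]. *)
exists (size X).+2, (cons2 _ (2 *: y0) y0 (fun i => t`_i)),
  (cons2 _ (- e) (2 * e) (fun i => coord t i x)); split.
- move=> i; rewrite /cons2; case: unliftP => [j _|_]; last exact: double.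
  by case: unliftP => [h _|//]; apply/XA/mem_nth.
- rewrite !big_ord_recl /cons2 /= unlift_none !liftK unlift_none.
  under eq_bigr do rewrite !liftK.
  by rewrite addrA mulr_natl mulr2n addrA addNr add0r subrK.
- rewrite !big_ord_recl /cons2 /= unlift_none !liftK unlift_none.
  under eq_bigr do rewrite !liftK.
  by rewrite -coord_span // scalerA addrA -scalerDl mulrC mulrN addNr scale0r add0r.
Qed.

(** Equalities between two coordinates survive affine combinations, so a vector of the hull
    vanishing before a rigid position vanishes there too. At a free position, the difference [y - z]
    has its first nonzero coordinate. *)
Lemma has_dim_leading_positions (R : realType) (N : nat) (A : set 'rV[R]_N)
    (D : pred 'I_N) :
  A !=set0 -> (forall y, A y -> A (2 *: y)) ->
  (forall j, ~~ D j -> exists2 s : 'I_N, (s < j)%N &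
     forall y, A y -> y ord0 j = y ord0 s) ->
  (forall j, D j -> exists y z, [/\ A y, A z,
     forall i : 'I_N, (i < j)%N -> y ord0 i = z ord0 i & y ord0 j != z ord0 j]) ->
  has_dim A (\sum_(j < N) D j)%N.
Proof.
move=> A0 double rigid free; have [U UE] := affine_hull_vspace A0 double.
have AU y : A y -> y \in U.
  move=> Ay; apply/UE; exists 1%N, (fun=> y), (fun=> 1).
  by rewrite !big_ord1 scale1r.
exists 0, U; split.
  apply/seteqP; split=> [x /UE xU|_ [u uU <-]]; first by exists x; rewrite ?add0r.
  by rewrite add0r; apply/UE.
apply: dim_leading_positions => [j u /rigid[s sj js] /UE[l [p [c [pA _ ->]]]] u0|].
  rewrite -[RHS](u0 s sj) !summxE; apply: eq_bigr => i _.
  by rewrite !mxE js.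
move=> j /free[y [z [Ay Az yz ne]]]; exists (y - z); first by rewrite rpredB ?AU.
by split=> [i /yz|]; rewrite !mxE ?subr_eq0 // => ->; rewrite subrr.
Qed.

(** * Extending order isomorphisms by one point *)

(** By finiteness there are [p < q] with [L] weakly below [p] and [H] weakly above [q], even if a
    list is empty; two points strictly between [p] and [q] do. Having two of them is what makes a
    position free. *)
Lemma exists_between (R : realFieldType) (L H : seq R) :
  (forall l h, l \in L -> h \in H -> l < h) ->
  exists v w, v != w /\ forall x, x = v \/ x = w ->
    (forall l, l \in L -> l < x) /\ (forall h, h \in H -> x < h).
Proof.
move=> LH.
have [p [pL pH]] : exists p, (forall l, l \in L -> l <= p) /\
    (forall h, h \in H -> p < h).
  elim: L LH => [|l L IH] LH.
    elim: H {LH} => [|h H [p [_ pH]]]; first by exists 0.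
    exists (Num.min p (h - 1)); split=> // x.
    rewrite inE gt_min => /orP[/eqP ->|/pH ->//].
    by rewrite ltrBlDr ltrDl ltr01 orbT.
  have [|p [pL pH]] := IH.
    by move=> l' h l'L hH; apply: LH => //; rewrite inE l'L orbT.
  exists (Num.max l p); split=> [x|h hH].
    by rewrite inE le_max => /orP[/eqP ->|/pL ->]; rewrite ?lexx ?orbT.
  by rewrite gt_max pH // LH // mem_head.
have [q [pq qH]] : exists q, p < q /\ (forall h, h \in H -> q <= h).
  elim: H {LH} pH => [|h H IH] pH; first by exists (p + 1); rewrite ltrDl ltr01.
  have [h' h'H|q [pq qH]] := IH; first by apply: pH; rewrite inE h'H orbT.
  exists (Num.min h q); split; first by rewrite lt_min pq pH ?mem_head.
  by move=> x; rewrite inE ge_min => /orP[/eqP ->|/qH ->]; rewrite ?lexx ?orbT.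
have [pv vq] := midf_lt pq; have [pw wv] := midf_lt pv.
exists ((p + q) / 2), ((p + (p + q) / 2) / 2); split; first by rewrite gt_eqF.
by move=> x [] ->; split=> [l /pL lp|h /qH qh];
  [exact: le_lt_trans pv | exact: lt_le_trans qh
  |exact: le_lt_trans pw | exact: lt_le_trans (lt_trans wv vq) qh].
Qed.

Lemma comparison_holds_le (R : realType) (c : comparison) (x y x' y' : R) :
  comparison_holds c x y -> comparison_holds c x' y' -> (x <= y) = (x' <= y').
Proof.
by case: c => /= [-> ->|h h'|h h']; [rewrite !lexx | rewrite (ltW h) (ltW h')
  | rewrite !leNgt h h'].
Qed.

(** Since [i] and [j] may be swapped, ties and strict inequalities are preserved as well. *)
Definition order_iso (R : realType) (s : seq nat) (f g : nat -> R) : Prop :=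
  {in s &, forall i j, (f i <= f j) = (g i <= g j)}.

Lemma order_iso_holds (R : realType) (s : seq nat) (f g : nat -> R)
    (c : comparison) (i j : nat) :
  order_iso s f g -> i \in s -> j \in s ->
  comparison_holds c (f i) (f j) -> comparison_holds c (g i) (g j).
Proof.
move=> fg i_s js; case: c => /=; rewrite ?ltNge ?fg // => e.
by apply/le_anti; rewrite -!fg // e lexx.
Qed.

(** If [f m] repeats an earlier value, the new value is forced. Otherwise it may lie anywhere in the
    gap between the images of the smaller and of the larger values. *)
Lemma extend_order_iso (R : realType) (s : seq nat) (f g : nat -> R) (m : nat) :
  order_iso s f g ->
  exists v w, (f m \notin map f s -> v != w) /\
    forall h, {in s, h =1 g} -> h m = v \/ h m = w -> order_iso (m :: s) f h.
Proof.
move=> fg.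
suff [v [w [vw vwP]]] : exists v w, (f m \notin map f s -> v != w) /\
    forall x, x = v \/ x = w -> forall i, i \in s ->
    (f i <= f m) = (g i <= x) /\ (f m <= f i) = (x <= g i).
  exists v, w; split=> // h hg /vwP hm i j; rewrite !inE.
  case/predU1P=> [->|i_s] /predU1P[->|js]; rewrite ?lexx //.
  - by rewrite (hg j) //; case: (hm j js).
  - by rewrite (hg i) //; case: (hm i i_s).
  - by rewrite !hg //; apply: fg.
have [|us] := boolP (f m \in map f s).
  case/mapP => j js ->; exists (g j), (g j); split=> // x [] -> i i_s;
  by split; apply: fg.
pose L := [seq g i | i <- s & f i < f m]; pose H := [seq g i | i <- s & f m < f i].
have [l h|v [w [vw vwP]]] := @exists_between _ L H.
  case/mapP=> i; rewrite mem_filter => /andP[iu i_s] ->.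
  case/mapP=> j; rewrite mem_filter => /andP[uj js] ->.
  by rewrite ltNge -fg // -ltNge (lt_trans iu).
exists v, w; split=> // x /vwP[xL xH] i i_s.
have [iu|ui|iu] := ltgtP (f i) (f m).
- have gx : g i < x by apply/xL/map_f; rewrite mem_filter iu.
  by rewrite (ltW gx) leNgt gx.
- have gx : x < g i by apply/xH/map_f; rewrite mem_filter ui.
  by rewrite (ltW gx) leNgt gx.
- by case/negP: us; rewrite -iu map_f.
Qed.

(** This will turn [n(T)] into a count of free positions. The induction appends on the right, which
    leaves the earlier prefixes unchanged. *)
Lemma size_undup_first_occurrences (T : eqType) (x0 : T) (s : seq T) :
  size (undup s) = (\sum_(i < size s) (nth x0 s i \notin take i s))%N.
Proof.
elim/last_ind: s => [|s x IH]; first by rewrite big_ord0.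
rewrite size_rcons big_ord_recr /= nth_rcons ltnn eqxx.
rewrite -cats1 take_size_cat //.
have -> : size (undup (s ++ [:: x])) = (size (undup s) + (x \notin s))%N.
  rewrite (perm_size (perm_undup (s2 := x :: s) _)) => [/=|y].
    by case: ifP; rewrite /= ?addn0 ?addn1.
  by rewrite mem_cat !inE orbC.
rewrite IH; congr addn; apply: eq_bigr => i _.
by rewrite nth_cat ltn_ord takel_cat // ltnW.
Qed.

(** * Cells and the recurrence as conditions on the order of terms *)

Lemma Pv_rowP (R : realType) (n : nat) (v : vertex R n) (f : nat -> R) :
  Pv v (\row_s f s) <->
  forall r t : 'I_n, comparison_holds (val v (r, t)) (f r) (f t).
Proof. by split=> h r t; have := h r t; rewrite !mxE. Qed.

Lemma Pv_order_iso (R : realType) (n : nat) (v : vertex R n) (f g : nat -> R) :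
  Pv v (\row_s f s) -> Pv v (\row_s g s) -> order_iso (iota 0 n) f g.
Proof.
move=> vf vg i j; rewrite !mem_iota !add0n => /andP[_ i_n] /andP[_ jn].
by have := Pv_le (Ordinal i_n) (Ordinal jn) vf vg; rewrite !mxE.
Qed.

Lemma order_iso_Pv (R : realType) (n : nat) (v : vertex R n) (f g : nat -> R) :
  order_iso (iota 0 n) f g -> Pv v (\row_s f s) -> Pv v (\row_s g s).
Proof.
move=> fg /Pv_rowP vf; apply/Pv_rowP => r t.
by apply: order_iso_holds fg _ _ (vf r t); rewrite mem_iota add0n ltn_ord.
Qed.

Lemma eq_Pv (R : realType) (n : nat) (f g : nat -> R) (v : vertex R n) :
  (forall s, (s < n)%N -> f s = g s) ->
  Pv v (\row_s f s) -> Pv v (\row_s g s).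
Proof.
move=> fg; apply: (order_iso_Pv (f := f) (g := g)) => i j.
by rewrite !mem_iota => /fg-> /fg->.
Qed.

Arguments eq_Pv {R n} f g {v}.

Lemma exists_vertex (R : realType) (n : nat) (y : 'rV[R]_n) :
  exists v : vertex R n, Pv v y.
Proof.
pose c := [ffun p : 'I_n * 'I_n => if y ord0 p.1 < y ord0 p.2 then Lt
  else if y ord0 p.2 < y ord0 p.1 then Gt else Eq].
have cy : cell c y by move=> r t; rewrite ffunE /=; case: ltgtP.
have c0 : `[< cell (R := R) c !=set0 >] by apply/asboolP; exists y.
by exists (exist _ c c0).
Qed.

Lemma entry_row (R : realType) (m : nat) (f : nat -> R) (i : nat) :
  (i < m)%N -> entry (\row_(s < m) f s) i = f i.
Proof. by move=> im; rewrite /entry insubT /= mxE. Qed.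

Lemma entry_ord (R : realType) (m : nat) (y : 'rV[R]_m) (i : 'I_m) :
  entry y i = y ord0 i.
Proof. by rewrite /entry valK. Qed.

(** The recurrence at a single place for boolean [a]: infinite terms drop out, and only the order of
    [f 0], ..., [f n] matters. *)
Definition recurrence_at (R : realType) (n : nat) (a : 'I_n.+1 -> \bar R)
    (f : nat -> R) : Prop :=
  exists p q : 'I_n.+1, [/\ p != q, a p = 0%E, a q = 0%E, f p = f q &
    forall l, a l = 0%E -> f p <= f l].

Section BooleanVector.
Variables (R : realType) (n : nat) (a : 'I_n.+1 -> \bar R).
Hypotheses (hn : (1 <= n)%N) (ha : tropical_boolean a).

(** The index [i0] makes the minimum finite, so infinite terms never attain it. The size [m] is
    arbitrary in order to serve both the recurrence, with [n+1] terms, and [Sv], with [n]. *)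
Lemma mem_argmins_boolean (m : nat) (b : 'I_m -> \bar R) (F : 'I_m -> \bar R)
    (f : 'I_m -> R) (i0 t : 'I_m) :
  b i0 = 0%E -> (forall i, b i = 0%E \/ b i = +oo%E) ->
  (forall i, F i = (f i)%:E + b i)%E ->
  t \in argmins F <-> b t = 0%E /\ forall l, b l = 0%E -> f t <= f l.
Proof.
move=> b0 bb FE; rewrite in_argmins; split=> [/forallP tmin|[bt tmin]].
  have bt : b t = 0%E.
    case: (bb t) => // bt; have := tmin i0.
    by rewrite !FE bt b0 addey // adde0 leye_eq.
  by split=> // l bl; have := tmin l; rewrite !FE bt bl !adde0 lee_fin.
apply/forallP => l; rewrite !FE bt adde0.
case: (bb l) => bl; last by rewrite bl addey // leey.
by rewrite bl adde0 lee_fin tmin.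
Qed.

Lemma recurrence_atP (f : nat -> R) :
  (1 < #|argmins (fun i : 'I_n.+1 => (f i)%:E + a i)%E|)%N <->
  recurrence_at a f.
Proof.
have [a0 _ ab] := ha.
have E t := @mem_argmins_boolean _ a _ (fun i => f i) ord0 t a0 ab
  (fun i => erefl).
split=> [/card_gt1P[p [q [/E[ap pm] /E[aq qm] pq]]]|[p [q [pq ap aq fpq pm]]]].
  by exists p, q; split=> //; apply/le_anti; rewrite pm ?qm.
apply/card_gt1P; exists p, q; split=> //; apply/E; split=> // l al.
by rewrite -fpq pm.
Qed.

Lemma order_iso_recurrence_at (f g : nat -> R) :
  order_iso (iota 0 n.+1) f g -> recurrence_at a f -> recurrence_at a g.
Proof.
move=> fg [p [q [pq ap aq fpq pm]]].
have mem (i : 'I_n.+1) : nat_of_ord i \in iota 0 n.+1.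
  by rewrite mem_iota add0n ltn_ord.
exists p, q; split=> // [|l /pm]; last by rewrite fg.
exact: (order_iso_holds (c := Eq) fg).
Qed.

Lemma mem_SvP (v : vertex R n) (f : nat -> R) (t : 'I_n) :
  Pv v (\row_s f s) ->
  t \in Sv a v <-> a (widen_ord (leqnSn n) t) = 0%E /\
    forall l : 'I_n, a (widen_ord (leqnSn n) l) = 0%E -> f t <= f l.
Proof.
have [a0 _ ab] := ha; move=> vf; rewrite (SvE ha vf).
apply: (@mem_argmins_boolean _ (fun l => a (widen_ord (leqnSn n) l)) _
  (fun i => f i) (Ordinal hn)) => [|i|i]; last by rewrite mxE addeC.
  by rewrite -a0; congr a; apply: val_inj.
exact: ab.
Qed.

Lemma Sv_inhabited (v : vertex R n) : exists t, t \in Sv a v.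
Proof.
pose F (t : 'I_n) := (a (widen_ord (leqnSn n) t) + (Defs.point v ord0 t)%:E)%E.
have [t _ tmin] := arg_minP F (i0 := Ordinal hn) (P := xpredT) isT.
by exists t; rewrite in_argmins; apply/forallP => i; apply: tmin.
Qed.

Lemma edge_seqP (v w : vertex R n) :
  edge a v w -> exists f : nat -> R,
    [/\ Pv v (\row_s f s), Pv w (\row_s f s.+1) & recurrence_at a f].
Proof.
move=> [y [vy wy ry]]; exists (entry y); split=> //.
by apply/recurrence_atP; apply: (ry 0%N).
Qed.

Lemma last_coord_newP (w : vertex R n) (f : nat -> R) (s : nat) :
  last_coord_new w -> Pv w (\row_s f s.+1) -> (0 < s < n)%N -> f n != f s.
Proof.
move=> new wf /andP[s0 sn]; apply/eqP.
have n1 : (n.-1 < n)%N by rewrite prednK.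
have s1 : (s.-1 < n)%N by apply: leq_ltn_trans sn; apply: leq_pred.
have := new _ wf (Ordinal s1) (Ordinal n1) erefl.
by rewrite !mxE /= !prednK //; apply; rewrite -ltnS !prednK.
Qed.

(** For a non-augmenting edge, copying the position of [f n] among all of [f 0], ..., [f (n-1)]
    suffices. For an augmenting edge this could force the value, as [f n] may equal [f 0]; so only
    the order at positions 1 to [n] is copied. This settles [Pv w], but the recurrence then needs
    its own argument. *)
Lemma edge_extension (v w : vertex R n) (g : nat -> R) :
  edge a v w -> Pv v (\row_s g s) ->
  exists x x', (augmenting a v w -> x != x') /\
    forall h, (forall s, (s < n)%N -> h s = g s) -> h n = x \/ h n = x' ->
      Pv w (\row_s h s.+1) /\ recurrence_at a h.
Proof.
move=> vw vg; have [f [vf wf rf]] := edge_seqP vw.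
have fg := Pv_order_iso vf vg.
have shift (h : nat -> R) : order_iso (n :: iota 1 n.-1) f h ->
    Pv w (\row_s h s.+1).
  move=> fh; apply: (order_iso_Pv (f := f \o S) (g := h \o S)) wf => i j.
  rewrite !mem_iota !add0n /= => i_n jn.
  have mem l : (l < n)%N -> l.+1 \in n :: iota 1 n.-1.
    by rewrite inE mem_iota add1n prednK // leq_eqVlt.
  by apply: fh; apply: mem.
have [[_ S0 new]|rigid] := pselect (augmenting a v w); last first.
  have [x [x' [_ xP]]] := extend_order_iso n fg.
  exists x, x'; split=> // h hg hn'; have {xP} fh := xP h _ hn'.
  have {}fh : order_iso (n :: iota 0 n) f h.
    by apply: fh => s; rewrite mem_iota add0n => sn; apply: hg.
  have sub s : (s <= n)%N -> s \in n :: iota 0 n.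
    by rewrite leq_eqVlt inE mem_iota add0n.
  split.
    apply: shift => i j i_n jn; apply: fh; apply: sub.
      move: i_n; rewrite inE mem_iota add1n prednK //.
      by move=> /predU1P[->|/andP[_ /ltnW]].
    move: jn; rewrite inE mem_iota add1n prednK //.
    by move=> /predU1P[->|/andP[_ /ltnW]].
  apply: order_iso_recurrence_at rf => i j.
  by rewrite !mem_iota !add0n !ltnS /= => i_n jn; apply: fh; apply: sub.
(* [Sv a v] is nonempty and is not the singleton of 0, so it has a positive element. *)
have [t tS t0] : exists2 t : 'I_n, t \in Sv a v & (0 < t)%N.
  apply: contrapT => nt.
  have only0 (t : 'I_n) : t \in Sv a v -> t = 0%N :> nat.
    move=> tS; apply/eqP; rewrite -leqn0 leqNgt; apply/negP => t0.
    by apply: nt; exists t.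
  apply: S0; apply/setP => t; rewrite [RHS]inE; apply/idP/eqP => [/only0//|t0].
  have [u uS] := Sv_inhabited v; suff -> : t = u by [].
  by apply: val_inj; rewrite /= t0 (only0 u uS).
have /(mem_SvP _ vf)[at0 tmin] := tS; have /(mem_SvP _ vg)[_ tming] := tS.
have fnt : f n != f t by apply: last_coord_newP new wf _; rewrite t0 ltn_ord.
(* Position 0 is dropped here, so that [f n] is new among the remaining values and two choices are
   left. *)
have fg1 : order_iso (iota 1 n.-1) f g.
  move=> i j; rewrite !mem_iota add1n prednK // => /andP[_ i_n] /andP[_ jn].
  by apply: fg; rewrite mem_iota add0n.
have [x [x' [xx' xP]]] := extend_order_iso n fg1.
exists x, x'; split=> [_|h hg hx].
  apply: xx'; apply/mapP => -[s]; rewrite mem_iota add1n prednK // => sn.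
  by apply/eqP; apply: last_coord_newP new wf sn.
have fh : order_iso (n :: iota 1 n.-1) f h.
  by apply: xP hx => s; rewrite mem_iota add1n prednK // => /andP[_ /hg].
split; first exact: shift.
have ltn_or_max (l : 'I_n.+1) : l = n :> nat \/
    exists2 l' : 'I_n, l = widen_ord (leqnSn n) l' & l = l' :> nat.
  have [ln|nl] := ltnP l n; last first.
    by left; apply/eqP; rewrite eqn_leq nl -ltnS ltn_ord.
  by right; exists (Ordinal ln) => //; apply: val_inj.
pose t' := widen_ord (leqnSn n) t.
(* The minimum of the first n terms is attained at t >= 1, so by newness the
   next term is strictly larger; thus the minimum is attained twice already
   among the first n terms, even if f n happens to equal the discarded f 0. *)
have [p [q [pq ap aq fpq pm]]] := rf.
have before (r r' : 'I_n.+1) : r' != r -> a r' = 0%E -> f r = f r' ->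
    (forall l, a l = 0%E -> f r <= f l) ->
    exists2 l : 'I_n, r = widen_ord (leqnSn n) l & r = l :> nat.
  move=> rr' ar' frr' rm; have [rn|//] := ltn_or_max r.
  have [r'n|[l r'l rl]] := ltn_or_max r'.
    by case/eqP: rr'; apply: val_inj; rewrite /= rn r'n.
  case/eqP: fnt; have -> : f n = f r by rewrite rn.
  apply/le_anti.
  by have /= -> := rm t' at0; rewrite frr' rl tmin // -r'l.
have [p1 pE p1E] : exists2 l : 'I_n, p = widen_ord (leqnSn n) l & p = l :> nat.
  by apply: before fpq pm; rewrite // eq_sym.
have [q1 qE q1E] : exists2 l : 'I_n, q = widen_ord (leqnSn n) l & q = l :> nat.
  by apply: (before q p) => // l /pm; rewrite fpq.
have mem (l : 'I_n) : nat_of_ord l \in iota 0 n.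
  by rewrite mem_iota add0n ltn_ord.
have gpq : g p = g q.
  by rewrite p1E q1E; apply: (order_iso_holds (c := Eq) fg); rewrite // -p1E -q1E.
have gpt : g p <= g t by rewrite p1E -fg // -p1E; have /= := pm t' at0.
exists p, q; split=> //; first by rewrite p1E q1E !hg // -p1E -q1E.
move=> l al; rewrite [h p]hg; last by rewrite p1E.
apply: le_trans gpt _.
have [->|[l1 lE l1E]] := ltn_or_max l; last by rewrite hg l1E // tming // -lE.
(* The remaining inequality [g t <= h n] only involves positions between 1 and [n], where [fh]
   applies. It comes from [f t = f p <= f n], the latter because [a] is 0 at [ord_max]. *)
rewrite -hg // -fh ?inE ?eqxx //; last first.
  by rewrite mem_iota t0 add1n prednK // ltn_ord orbT.
rewrite (_ : f t = f p).
  by have [_ an _] := ha; apply: (pm ord_max).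
by apply/le_anti; have /= -> := pm t' at0; rewrite p1E tmin // -pE.
Qed.

(** A minimal index below [n] belongs to [Sv a v]. If that set is the singleton of 0, a minimum
    attained twice must be attained at 0 and [n]. Otherwise the last coordinate repeats an earlier
    one throughout [Pv w]. *)
Lemma rigid_edge (v w : vertex R n) :
  edge a v w -> ~ augmenting a v w -> exists2 s, (s < n)%N &
    forall h : nat -> R, Pv v (\row_s h s) -> Pv w (\row_s h s.+1) ->
      recurrence_at a h -> h n = h s.
Proof.
move=> vw rigid.
have [S0|S0] := pselect (Sv a v = [set t : 'I_n | t == 0%N :> nat]%SET).
  exists 0%N => // h vh _ [p [q [pq ap aq hpq pm]]].
  have zero (r : 'I_n.+1) : a r = 0%E ->
      (forall l, a l = 0%E -> h r <= h l) -> r = n :> nat \/ r = 0%N :> nat.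
    move=> ar rm; have [rn|nr] := ltnP r n; last first.
      by left; apply/eqP; rewrite eqn_leq nr -ltnS ltn_ord.
    right; pose r' := Ordinal rn.
    have rE : widen_ord (leqnSn n) r' = r by apply: val_inj.
    suff : r' \in Sv a v by rewrite S0 inE => /eqP.
    by apply/(mem_SvP _ vh); rewrite rE; split=> // l al; apply: (rm _ al).
  have [pE|pE] := zero p ap pm; have [|qE|qE] := zero q aq.
  - by move=> l /pm; rewrite hpq.
  - by case/eqP: pq; apply: val_inj; rewrite /= pE qE.
  - by move: hpq; rewrite pE qE.
  - by move=> l /pm; rewrite hpq.
  - by move: hpq; rewrite pE qE => ->.
  - by case/eqP: pq; apply: val_inj; rewrite /= pE qE.
have : ~ last_coord_new w by move=> new; apply: rigid.
move=> /existsNP[y /not_implyP[wy /existsNP[s /existsNP[t]]]].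
move=> /not_implyP[tn /not_implyP[sn /contrapT yts]].
(* Coordinate [s] of the window of [w] is term [s+1] of [h]. *)
exists s.+1 => [|h _ wh _]; first by rewrite -ltn_predRL.
have := Pv_le s t wy wh; have := Pv_le t s wy wh.
rewrite yts lexx !mxE tn prednK // => /esym ts /esym st.
by apply/le_anti; rewrite ts st.
Qed.

End BooleanVector.

(** * Building the points of [QT] term by term *)

Lemma inord_widen (k : nat) (i : 'I_k) : inord i = widen_ord (leqnSn k) i.
Proof. by apply: val_inj; rewrite /= inordK // ltnS ltnW. Qed.

Lemma inord_lift (k : nat) (i : 'I_k) : inord i.+1 = lift ord0 i.
Proof. by apply: val_inj; rewrite /= inordK // ltnS ltn_ord. Qed.

Section PathExtension.
Variables (R : realType) (n : nat) (a : 'I_n.+1 -> \bar R).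
Hypotheses (hn : (1 <= n)%N) (ha : tropical_boolean a).
Variables (k : nat) (T : 'I_k.+1 -> vertex R n).
Hypothesis (hT : is_path a T).

(* The conditions defining [QT a T] that only involve the first [m] terms. *)
Definition follows (m : nat) (z : nat -> R) : Prop :=
  [/\ forall r t : 'I_n, (r < m)%N -> (t < m)%N ->
        comparison_holds (val (T ord0) (r, t)) (z r) (z t),
      forall i : 'I_k.+1, (i + n <= m)%N -> Pv (T i) (\row_s z (i + s)%N) &
      forall j, (j + n < m)%N -> recurrence_at a (fun i => z (j + i)%N)].

(** From [n] on, term [m] is the last coordinate of window [m - n + 1], hence is governed by the
    edge numbered [m - n]. *)
Definition free_position (m : nat) : bool :=
  if (m < n)%N then
    entry (Defs.point (T ord0)) m \notin
      [seq entry (Defs.point (T ord0)) i | i <- iota 0 m]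
  else `[< augmenting a (T (inord (m - n))) (T (inord (m - n).+1)) >].

Lemma path_edge (i : nat) :
  (i < k)%N -> edge a (T (inord i)) (T (inord i.+1)).
Proof.
move=> ik; have := hT (Ordinal ik).
by rewrite -inord_widen -inord_lift.
Qed.

Lemma row_entry (m : nat) (y : 'rV[R]_m) : \row_(s < m) entry y s = y.
Proof. by apply/rowP => s; rewrite mxE entry_ord. Qed.

Lemma eq_follows (m : nat) (z z' : nat -> R) :
  (forall i, (i < m)%N -> z i = z' i) -> follows m z -> follows m z'.
Proof.
move=> zz' [z1 z2 z3]; split=> [r t rm tm|i im|j jm].
- by rewrite -!zz' //; apply: z1.
- apply: (eq_Pv (fun s => z (i + s)%N) (fun s => z' (i + s)%N)) (z2 i im).
  move=> s sn; apply: zz'.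
  by apply: leq_trans im; rewrite ltn_add2l.
- apply: order_iso_recurrence_at (z3 j jm) => s t.
  rewrite !mem_iota !add0n !ltnS /= => sn tn.
  by rewrite !zz' // (leq_ltn_trans _ jm) // leq_add2l.
Qed.

Lemma sub_follows (m m' : nat) (z : nat -> R) :
  (m <= m')%N -> follows m' z -> follows m z.
Proof.
move=> mm' [z1 z2 z3]; split=> [r t rm tm|i im|j jm].
- by apply: z1; apply: leq_trans mm'.
- by apply: z2; apply: leq_trans mm'.
- by apply: z3; apply: leq_trans mm'.
Qed.

(** The first [n] terms copy the order of a chosen point of the initial cell; each later term comes
    from [edge_extension] applied to the last window. *)
Lemma follows_step (m : nat) (z : nat -> R) :
  (m < k + n)%N -> follows m z ->
  exists x x', (free_position m -> x != x') /\
    forall z', (forall i, (i < m)%N -> z' i = z i) -> z' m = x \/ z' m = x' ->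
      follows m.+1 z'.
Proof.
move=> mN [z1 z2 z3]; rewrite /free_position.
set p := entry (Defs.point (T ord0)).
have Tp : Pv (T ord0) (\row_s p s) by rewrite row_entry; apply: pointP.
have {}Tp := (Pv_rowP _ _).1 Tp.
case: ltnP => [mn|nm].
  have pz : order_iso (iota 0 m) p z.
    move=> i j; rewrite !mem_iota !add0n /= => im jm.
    have i_n := ltn_trans im mn; have jn := ltn_trans jm mn.
    exact: comparison_holds_le (Tp (Ordinal i_n) (Ordinal jn))
      (z1 (Ordinal i_n) (Ordinal jn) im jm).
  have [x [x' [xx' xP]]] := extend_order_iso m pz.
  exists x, x'; split=> // z' z'z hz'.
  have {xP} pz' : order_iso (m :: iota 0 m) p z'.
    by apply: xP hz' => s; rewrite mem_iota => /z'z.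
  have mem i : (i < m.+1)%N -> i \in m :: iota 0 m.
    by rewrite ltnS leq_eqVlt inE mem_iota.
  have z'1 (r t : 'I_n) : (r < m.+1)%N -> (t < m.+1)%N ->
      comparison_holds (val (T ord0) (r, t)) (z' r) (z' t).
    by move=> rm tm; apply: order_iso_holds pz' _ _ (Tp r t); apply: mem.
  split=> // [i im|j].
    (* At most [n] terms are present, so only window 0 can be complete, and no recurrence condition
       applies yet. *)
    have i0 : i = ord0.
      apply: val_inj; apply/eqP; rewrite -leqn0 -(leq_add2r n).
      exact: leq_trans im mn.
    have nm : (n <= m.+1)%N by apply: leq_trans im; rewrite leq_addl.
    by rewrite i0; apply/Pv_rowP => r t; apply: z'1; apply: leq_trans nm.
  by move=> jm; have := leq_ltn_trans (leq_addl j n) jm; rewrite ltnS leqNgt mn.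
set i := (m - n)%N; have mE : m = (i + n)%N by rewrite subnK.
have ik : (i < k)%N by rewrite ltn_subLR // addnC.
have Ti : Pv (T (inord i)) (\row_s z (i + s)%N).
  have iE : nat_of_ord (inord i : 'I_k.+1) = i by rewrite inordK // ltnS ltnW.
  by have := z2 (inord i); rewrite iE -mE; apply.
have [x [x' [xx' xP]]] :=
  edge_extension hn ha (g := fun s => z (i + s)%N) (path_edge ik) Ti.
exists x, x'; split=> [/asboolP/xx' //|z' z'z hz'].
have [] := xP (fun s => z' (i + s)%N).
- by move=> s sn; apply: z'z; rewrite mE ltn_add2l.
- by rewrite -mE.
move=> wz' rz'; split=> [r t _ _|i' |j].
- have rn l : (l < n)%N -> (l < m)%N by move=> ln; apply: leq_trans nm.
  by rewrite !z'z ?rn //; apply: z1; rewrite ?rn.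
(* The new term completes only window [i+1] and, below, the recurrence at [i]; all other conditions
   are inherited from [z]. *)
- rewrite leq_eqVlt ltnS => /predU1P[i'E|i'm].
    have {}i'E : nat_of_ord i' = i.+1.
      by apply/eqP; rewrite -(eqn_add2r n) i'E mE addSn.
    have -> : i' = inord i.+1 by apply: val_inj; rewrite /= inordK ?i'E.
    rewrite inordK //.
    apply: (eq_Pv (fun s => z' (i + s.+1)%N) (fun s => z' (i.+1 + s)%N)) wz'.
    by move=> s sn; rewrite addSnnS.
  apply: (eq_Pv (fun s => z (i' + s)%N) (fun s => z' (i' + s)%N)) (z2 i' i'm).
  move=> s sn; rewrite z'z //.
  by apply: leq_trans i'm; rewrite ltn_add2l.
- rewrite ltnS leq_eqVlt => /predU1P[jE|jm].
    have -> // : j = i by apply/eqP; rewrite -(eqn_add2r n) jE mE.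
  apply: order_iso_recurrence_at (z3 j jm) => s t.
  rewrite !mem_iota !add0n !ltnS /= => sn tn.
  by rewrite !z'z // (leq_ltn_trans _ jm) // leq_add2l.
Qed.

(** No partial sequence gets stuck, so the two values offered at a free position both occur in [QT].
    The induction is on the number [d] of missing terms. *)
Lemma follows_extend (m : nat) (z : nat -> R) :
  (m <= k + n)%N -> follows m z ->
  exists2 z', (forall i, (i < m)%N -> z' i = z i) & follows (k + n) z'.
Proof.
move=> mN; rewrite -(subKn mN); move: (k + n - m)%N (leq_subr m (k + n)) => d.
elim: d z => [|d IH] z dN zd; first by exists z; rewrite // subn0 in zd.
have md : (k + n - d.+1)%N.+1 = (k + n - d)%N by rewrite -subSn // subSS.
have [|x [x' [_ xP]]] := follows_step _ zd; first by rewrite md leq_subr.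
pose z1 i := if i == (k + n - d.+1)%N then x else z i.
have zz1 i : (i < k + n - d.+1)%N -> z1 i = z i.
  by move=> im; rewrite /z1 ltn_eqF.
have [|z' z'z1 z'N] := IH z1 (ltnW dN).
  by rewrite -md; apply: xP => //; left; rewrite /z1 eqxx.
exists z' => // i im; rewrite z'z1 ?zz1 // -md.
exact: ltnW.
Qed.

Lemma rigid_position (m : nat) :
  (m < k + n)%N -> ~~ free_position m ->
  exists2 s, (s < m)%N & forall z, follows (k + n) z -> z m = z s.
Proof.
move=> mN; rewrite /free_position; set p := entry (Defs.point (T ord0)).
have Tp : Pv (T ord0) (\row_s p s) by rewrite row_entry; apply: pointP.
case: ltnP => [mn|nm].
  rewrite negbK => /mapP[s]; rewrite mem_iota add0n => /andP[_ sm] pms.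
  exists s => // z [_ z2 _].
  have pz := Pv_order_iso Tp (z2 ord0 (leq_addl _ _)).
  by apply: (order_iso_holds (c := Eq) pz _ _ pms);
    rewrite mem_iota add0n ?mn // (ltn_trans sm).
set i := (m - n)%N; have mE : m = (i + n)%N by rewrite subnK.
have ik : (i < k)%N by rewrite ltn_subLR // addnC.
move=> /asboolPn na; have [s sn sP] := rigid_edge hn ha (path_edge ik) na.
exists (i + s)%N; first by rewrite mE ltn_add2l.
have iE : nat_of_ord (inord i : 'I_k.+1) = i by rewrite inordK // ltnS ltnW.
have i1E : nat_of_ord (inord i.+1 : 'I_k.+1) = i.+1 by rewrite inordK.
move=> z [_ z2 z3]; rewrite mE; apply: (sP (fun s => z (i + s)%N)).
- by have := z2 (inord i); rewrite iE; apply; rewrite leq_add2r ltnW.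
- have := z2 (inord i.+1); rewrite i1E leq_add2r => /(_ ik).
  by apply: (eq_Pv (fun s => z (i.+1 + s)%N) (fun s => z (i + s.+1)%N)) => t tn;
    rewrite addSnnS.
- by apply: z3; rewrite ltn_add2r.
Qed.

Lemma exists_follows : exists z, follows (k + n) z.
Proof.
have z0 : follows 0 (fun=> 0).
  (* As [n] is positive, no window fits into zero terms. *)
  by split=> // i; rewrite leqn0 addn_eq0 (gtn_eqF hn) andbF.
by have [z _ zN] := follows_extend (leq0n _) z0; exists z.
Qed.

Lemma QT_follows (y : 'rV[R]_(k + n)) : QT a T y <-> follows (k + n) (entry y).
Proof.
split=> [[ry yT]|[_ y2 y3]].
  split=> [r t _ _|i _|j jN].
  - exact: (Pv_rowP _ _).1 (yT ord0) r t.
  - exact: yT.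
  - by apply/(recurrence_atP ha); apply: ry.
split=> [j jN|i].
  by apply: (recurrence_atP ha (fun i => entry y (j + i)%N)).2; apply: y3.
by apply: y2; rewrite leq_add2r -ltnS.
Qed.

Lemma sum_free_position :
  (\sum_(j < k + n) free_position j)%N =
  (num_augmenting a T + distinct_coords (T ord0))%N.
Proof.
rewrite -(big_mkord xpredT (fun j => nat_of_bool (free_position j))).
(* Splitting at [n]: the positions below count first occurrences in the initial cell, the later ones
   augmenting edges. *)
rewrite (big_cat_nat (n := n)) ?leq_addl //= addnC; congr addn.
  rewrite -{1}(add0n n) big_addn addnK big_mkord /num_augmenting -sum1_card.
  rewrite [RHS]big_mkcond /=; apply: eq_bigr => i _; rewrite inE /free_position.
  rewrite ltnNge leq_addl /= addnK.
  rewrite inord_widen inord_lift.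
  by case: asbool.
rewrite big_mkord /distinct_coords /distinct_at.
rewrite (size_undup_first_occurrences 0) size_map size_enum_ord.
apply: eq_bigr => i _; rewrite /free_position ltn_ord; congr (nat_of_bool (~~ _)).
have pE : [seq Defs.point (T ord0) ord0 j | j : 'I_n] =
    map (entry (Defs.point (T ord0))) (iota 0 n).
  rewrite -val_enum_ord -map_comp; apply: eq_map => j /=.
  by rewrite entry_ord.
rewrite pE (nth_map 0%N) ?size_iota // nth_iota // add0n -map_take take_iota.
by rewrite (minn_idPl (ltnW _)).
Qed.

Lemma has_dim_QT :
  has_dim (QT a T) (num_augmenting a T + distinct_coords (T ord0)).
Proof.
rewrite -sum_free_position.
have QT_row z : follows (k + n) z -> QT a T (\row_i z i).
  move=> zN; apply/QT_follows; apply: eq_follows zN => i iN.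
  by rewrite entry_row.
apply: (has_dim_leading_positions (D := fun j => free_position j)).
- by have [z zN] := exists_follows; exists (\row_i z i); apply: QT_row.
- move=> y; have E i : entry (2 *: y) i = 2 * entry y i.
    by rewrite /entry; case: insub => [j|] /=; rewrite ?mxE ?mulr0.
  (* Doubling preserves the order of the terms, hence every condition defining [QT]. *)
  have iso s : order_iso s (entry y) (entry (2 *: y)).
    by move=> i j _ _; rewrite !E ler_pM2l.
  move=> /QT_follows[y1 y2 y3]; apply/QT_follows; split=> [r t rN tN|i iN|j jN].
  + apply: order_iso_holds (iso [:: nat_of_ord r; nat_of_ord t]) _ _
      (y1 r t rN tN);
    by rewrite !inE eqxx ?orbT.
  + apply: (order_iso_Pv (f := fun s => entry y (i + s)%N)
      (g := fun s => entry (2 *: y) (i + s)%N)) (y2 i iN) => s t _ _.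
    by rewrite !E ler_pM2l.
  + apply: order_iso_recurrence_at (y3 j jN) => s t _ _.
    by rewrite !E ler_pM2l.
- move=> j /(rigid_position (ltn_ord j))[s sj sP].
  exists (Ordinal (ltn_trans sj (ltn_ord j))) => // y /QT_follows/sP.
  by rewrite -!entry_ord.
move=> j fj.
have [z zN] := exists_follows.
have [x [x' [xx' xP]]] :=
  follows_step (ltn_ord j) (sub_follows (ltnW (ltn_ord j)) zN).
(* One common prefix, continued at [j] by either of two distinct values and then completed to a
   point of [QT]. *)
pose zx c i := if i == j :> nat then c else z i.
have zxz c i : (i < j)%N -> zx c i = z i by move=> ij; rewrite /zx ltn_eqF.
have zxj c : zx c j = c by rewrite /zx eqxx.
have [||y1 y1x y1N] := @follows_extend j.+1 (zx x); first exact: ltn_ord.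
  by apply: xP; [exact: zxz | left].
have [||y2 y2x y2N] := @follows_extend j.+1 (zx x'); first exact: ltn_ord.
  by apply: xP; [exact: zxz | right].
exists (\row_i y1 i), (\row_i y2 i); split; [exact: QT_row | exact: QT_row | |].
  by move=> i ij; rewrite !mxE y1x ?y2x ?zxz // ltnS ltnW.
by rewrite !mxE y1x // y2x // !zxj xx'.
Qed.

End PathExtension.

(** * Dimension of each [QT], and covering of the prevariety *)

Theorem theorem6p6 (R : realType) (n : nat) (a : 'I_n.+1 -> \bar R)
    (hn : (1 <= n)%N) (ha : tropical_boolean a) :
  (forall (k : nat) (T : 'I_k.+1 -> vertex R n), is_path a T ->
     has_dim (QT a T) (num_augmenting a T + distinct_coords (T ord0))) /\
  (forall k : nat,
     \bigcup_(T in [set T : 'I_k.+1 -> vertex R n | is_path a T]) QT a T =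
     [set z : 'rV[R]_(k + n) | tropical_recurrent a z]).
Proof.
split=> [k T hT|k]; first exact: has_dim_QT.
apply/seteqP; split=> [z [T _ []] //|z rz].
(* Each window of [z] lies in some cell; these cells form a path, with the windows of length [n+1]
   as witnesses of its edges. *)
have [T Tz] := choice (fun i : 'I_k.+1 => exists_vertex (window z n i)).
exists T => // i; exists (window z n.+1 i).
have iN s : (s < n.+1)%N -> entry (window z n.+1 i) s = entry z (i + s)%N.
  exact: (entry_row (fun s => entry z (i + s)%N)).
split=> [||j].
- apply: (eq_Pv (fun s => entry z (i + s)%N)
    (fun s => entry (window z n.+1 i) s)) (Tz (widen_ord (leqnSn k) i)) => s sn;
  by rewrite iN // ltnW.
- apply: (eq_Pv (fun s => entry z (lift ord0 i + s)%N)
    (fun s => entry (window z n.+1 i) (1 + s)%N)) (Tz (lift ord0 i)) => s sn;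
  by rewrite iN // lift0 addSnnS.
(* A window of [n+1] terms carries a single recurrence condition, the one at 0. *)
rewrite -[X in (_ < X)%N]add1n ltn_add2r ltnS leqn0 => /eqP ->.
have := rz i; rewrite ltn_add2r => /(_ (ltn_ord i)).
congr (1 < #|argmins _|)%N.
by apply/funext => s; rewrite add0n iN.
Qed.
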